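(* Let $n\ge2$. The $n$-fruit cactus group $J_n$ has the presentation $$J_n=\big\langle \mathsf t_i,\ 1\le i\le n-1\ \big|\ \mathsf t_i^2=1;\ \mathsf t_i\mathsf t_j=\mathsf t_j\mathsf t_i\ \text{if } |i-j|>1;\ (\mathsf t_i\,\mathsf q_{k-1}\mathsf q_{k-j}\mathsf q_{k-1})^2=1\ \text{for } i+1<j<k\le n\big\rangle,$$ where $\mathsf q_i:=\mathsf t_1(\mathsf t_2\mathsf t_1)\cdots(\mathsf t_i\mathsf t_{i-1}\cdots\mathsf t_1)$; i.e. $J_n$ is isomorphic to the group with this presentation.
   Context: The $n$-fruit cactus group $J_n$ is the group with generators $s_{i,j}$, $1\le i<j\le n$, and relations: $s_{i,j}^2=1$; $s_{i,j}s_{k,l}=s_{k,l}s_{i,j}$ if $[i,j]\cap[k,l]=\emptyset$; $s_{i,j}s_{k,l}=s_{i+j-l,i+j-k}s_{i,j}$ if $[k,l]\subseteq[i,j]$. In the presentation, the $\mathsf t_i$ are regarded as abstract generators (the relations listed are relations known to hold among the shifted Bender--Knuth involutions). *)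

(* Defs.v *)
(* MathComp; boolp makes the congruence pres_cong a boolean relation. *)
From HB Require Import structures.
From mathcomp Require Import all_boot.
From mathcomp Require Import boolp.

Set Implicit Arguments.
Unset Strict Implicit.
Unset Printing Implicit Defensive.

Local Open Scope quotient_scope.

(* The letter (x, true) stands for the generator x, (x, false) for x^-1. *)
Notation word X := (seq (X * bool)).

Definition winv X (w : word X) : word X := rev [seq (a.1, ~~ a.2) | a <- w].

Section Presentation.

Variables (X : choiceType) (R : word X -> word X -> Prop).

(* Each pair R u v is read as the relation u = v. *)
Inductive pres_cong : word X -> word X -> Prop :=
| pres_rel u v of R u v : pres_cong u v
| pres_cancel a : pres_cong [:: a; (a.1, ~~ a.2)] [::]
| pres_refl u : pres_cong u u
| pres_sym u v of pres_cong u v : pres_cong v u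
| pres_trans u v w of pres_cong u v & pres_cong v w : pres_cong u w
| pres_cat u u' v v' of pres_cong u u' & pres_cong v v' :
    pres_cong (u ++ v) (u' ++ v').

Definition pres_eq : rel (word X) := fun u v => `[< pres_cong u v >].

Lemma pres_eq_refl : reflexive pres_eq.
Proof. by move=> u; apply/asboolP; apply: pres_refl. Qed.

Lemma pres_eq_sym : symmetric pres_eq.
Proof. by move=> u v; apply/asboolP/asboolP; apply: pres_sym. Qed.

Lemma pres_eq_trans : transitive pres_eq.
Proof.
by move=> v u w /asboolP uv /asboolP vw; apply/asboolP; apply: pres_trans uv vw.
Qed.

Canonical pres_equiv := EquivRel pres_eq pres_eq_refl pres_eq_sym pres_eq_trans.

(* The group with generators X and relations u = v for R u v. *)
Definition presented : Type := {eq_quot pres_equiv}.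
HB.instance Definition _ := Choice.on presented.

Definition pres_of (w : word X) : presented :=
  \pi_{eq_quot pres_equiv} w.

Definition pres_repr (g : presented) : word X :=
  repr (g : {eq_quot pres_equiv}).

Lemma pres_ofP u v : pres_of u = pres_of v <-> pres_cong u v.
Proof.
by split=> [/eqmodP/asboolP | uv]; last by apply/eqmodP/asboolP.
Qed.

Lemma pres_ofK g : pres_of (pres_repr g) = g.
Proof. exact: reprK. Qed.

Lemma cong_repr u : pres_cong (pres_repr (pres_of u)) u.
Proof. by apply/pres_ofP; rewrite pres_ofK. Qed.

Lemma winv_cat (u v : word X) : winv (u ++ v) = winv v ++ winv u.
Proof. by rewrite /winv map_cat rev_cat. Qed.

Lemma winvK : involutive (@winv X).
Proof.
move=> u; rewrite /winv map_rev revK -map_comp -[RHS]map_id.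
by apply: eq_map => -[x b] /=; rewrite negbK.
Qed.

Lemma cong_winvr u : pres_cong (u ++ winv u) [::].
Proof.
elim: u => [|a u IHu]; first exact: pres_refl.
rewrite -cat1s winv_cat -catA (catA u).
apply: pres_trans (pres_cancel a).
apply: (pres_cat (u := [:: a]) (u' := [:: a])); first exact: pres_refl.
by apply: (pres_cat (u' := [::])); last exact: pres_refl.
Qed.

Lemma cong_winvl u : pres_cong (winv u ++ u) [::].
Proof. by rewrite -[u in _ ++ u]winvK; apply: cong_winvr. Qed.

Lemma cong_winv u v : pres_cong u v -> pres_cong (winv u) (winv v).
Proof.
move=> uv; rewrite -[winv u]cats0.
apply: pres_trans (pres_cat (pres_refl _) (pres_sym (cong_winvr v))) _.
rewrite catA -[X in pres_cong _ X]cat0s; apply: pres_cat; last exact: pres_refl.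
apply: pres_trans (cong_winvl u).
by apply: pres_cat; [exact: pres_refl | exact: pres_sym].
Qed.

Definition pres_one := pres_of [::].
Definition pres_mul g h := pres_of (pres_repr g ++ pres_repr h).
Definition pres_inv g := pres_of (winv (pres_repr g)).

Lemma pres_mulE u v : pres_mul (pres_of u) (pres_of v) = pres_of (u ++ v).
Proof. by apply/pres_ofP; apply: pres_cat; apply: cong_repr. Qed.

Lemma pres_invE u : pres_inv (pres_of u) = pres_of (winv u).
Proof. by apply/pres_ofP; apply: cong_winv; apply: cong_repr. Qed.

Lemma pres_mulA : associative pres_mul.
Proof.
move=> f g h; rewrite -[f]pres_ofK -[g]pres_ofK -[h]pres_ofK.
by rewrite !pres_mulE catA.
Qed.

Lemma pres_mul1 : left_id pres_one pres_mul.
Proof. by move=> g; rewrite -[g]pres_ofK pres_mulE. Qed.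

Lemma pres_mulr1 : right_id pres_one pres_mul.
Proof. by move=> g; rewrite -[g]pres_ofK pres_mulE cats0. Qed.

Lemma pres_mulV : left_inverse pres_one pres_inv pres_mul.
Proof.
move=> g; rewrite -[g]pres_ofK pres_invE pres_mulE.
by apply/pres_ofP; apply: cong_winvl.
Qed.

Lemma pres_mulrV : right_inverse pres_one pres_inv pres_mul.
Proof.
move=> g; rewrite -[g]pres_ofK pres_invE pres_mulE.
by apply/pres_ofP; apply: cong_winvr.
Qed.

HB.instance Definition _ := isGroup.Build presented
  pres_mulA pres_mul1 pres_mulr1 pres_mulV pres_mulrV.

End Presentation.

Definition ivl (i j : nat) : pred nat := fun m => i <= m <= j.

Notation cactus_gen n :=
  {p : nat * nat | [&& 1 <= p.1, p.1 < p.2 & p.2 <= n]}.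

(* s_{i,j} as a one-letter word. The value outside 1 <= i < j <= n is junk:
   cactus_rel only uses it at indices inside that range. *)
Definition cactus_s (n i j : nat) : word (cactus_gen n) :=
  if insub (i, j) is Some p then [:: (p, true)] else [::].

Inductive cactus_rel (n : nat) :
    word (cactus_gen n) -> word (cactus_gen n) -> Prop :=
| cactus_invol i j of 1 <= i & i < j & j <= n :
    cactus_rel (cactus_s n i j ++ cactus_s n i j) [::]
| cactus_comm i j k l of 1 <= i & i < j & j <= n & 1 <= k & k < l & l <= n
    & [predI ivl i j & ivl k l] =i pred0 :
    cactus_rel (cactus_s n i j ++ cactus_s n k l)
      (cactus_s n k l ++ cactus_s n i j)
| cactus_flip i j k l of 1 <= i & i < j & j <= n & 1 <= k & k < l & l <= n
    & {subset ivl k l <= ivl i j} :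
    cactus_rel (cactus_s n i j ++ cactus_s n k l)
      (cactus_s n (i + j - l) (i + j - k) ++ cactus_s n i j).

Definition cactus (n : nat) : groupType := presented (@cactus_rel n).

Notation bk_gen n := {i : nat | 1 <= i <= n - 1}.

(* t_i as a one-letter word; again junk outside 1 <= i <= n - 1, where bk_rel
   never uses it. *)
Definition bk_t (n i : nat) : word (bk_gen n) :=
  if insub i is Some x then [:: (x, true)] else [::].

(* q_i = t_1 (t_2 t_1) ... (t_i t_{i-1} ... t_1) *)
Definition bk_q (n i : nat) : word (bk_gen n) :=
  flatten [seq flatten [seq bk_t n b | b <- rev (iota 1 a)] | a <- iota 1 i].

Inductive bk_rel (n : nat) : word (bk_gen n) -> word (bk_gen n) -> Prop :=
| bk_invol i of 1 <= i & i <= n - 1 : bk_rel (bk_t n i ++ bk_t n i) [::]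
| bk_comm i j of 1 <= i & i <= n - 1 & 1 <= j & j <= n - 1
    & (i.+1 < j) || (j.+1 < i) :
    bk_rel (bk_t n i ++ bk_t n j) (bk_t n j ++ bk_t n i)
| bk_cactus i j k of 1 <= i & i + 1 < j & j < k & k <= n :
    let w := bk_t n i ++ bk_q n (k - 1) ++ bk_q n (k - j) ++ bk_q n (k - 1) in
    bk_rel (w ++ w) [::].

Definition bk_group (n : nat) : groupType := presented (@bk_rel n).

(* Main.v *)
From HB Require Import structures.
Require Import Defs.
From mathcomp Require Import all_boot.
From mathcomp Require Import zify.

(** Two homomorphisms, inverse to each other on generators, are built from the
    presentations.

    Write p_i = t_i ... t_1 and q_i = p_1 ... p_i on the Bender-Knuth side. The
    map to the cactus group is forced by the wish that q_i go to s_{1,i+1}: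
    since p_i = q_{i-1} q_i and t_i = p_i p_{i-1}^-1, the generator t_i must go
    to s_{1,i} s_{1,i+1} s_{1,i} s_{1,i-1} (with s_{1,1} = s_{1,0} = 1). In the
    other direction, s_{i,j} is the conjugate of s_{1,j-i+1} by s_{1,j}, so it
    must go to q_{j-1} q_{j-i} q_{j-1}; call this word S_{i,j}.

    From t_i to s_{i,j}: the relations t_i^2 = 1 and the commutation of distant
    t_i alone make every q_i an involution (bkq_invol) and give
    p_m^-1 S_{i,j} p_m = S_{i+1,j+1} for j <= m (bks_conj_p). Peeling factors
    p_m off q_{j-1} then yields the reversal relation inside [1,j]
    (bks_flip1), and inside any [i,j] by applying it three times (bks_flip).
    The last family of Bender-Knuth relations says exactly that t_i commutes
    with S_{j,k} when i+1 < j, and this is the commutation of disjoint intervals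
    because S_{i,j} is a word in t_1, ..., t_{j-1} (bks_commute).

    From s_{i,j} to t_i: conjugation by the involution
    s_{1,i} s_{1,i+1} s_{1,i} moves [1,m] to [i-m,i-1] when m < i
    (prefix_conj), as s_{1,i-1} does. So the image of t_i commutes with s_{1,m}
    for m < i, and this gives the first two families of relations. In the third,
    the word in the q's goes to s_{j,k}, while the image of t_i is a word in the
    s_{1,m} with m <= i+1 < j, so it is commutation of disjoint intervals.

    The composites fix the generators by bks_cactus and bk_t_from_bks. *)

Set Implicit Arguments.
Unset Strict Implicit.
Unset Printing Implicit Defensive.

(** * The universal property of a presented group *)

Section UniversalProperty.

Local Open Scope group_scope.

Variables (X : choiceType) (R : word X -> word X -> Prop).

Definition word_eval (G : groupType) (f : X -> G) (w : word X) : G :=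
  \prod_(a <- w) (if a.2 then f a.1 else (f a.1)^-1).

Lemma word_eval_cat (G : groupType) (f : X -> G) u v :
  word_eval f (u ++ v) = word_eval f u * word_eval f v.
Proof. exact: big_cat. Qed.

Lemma word_eval_cong (G : groupType) (f : X -> G) :
  (forall u v, R u v -> word_eval f u = word_eval f v) ->
  forall u v, pres_cong R u v -> word_eval f u = word_eval f v.
Proof.
move=> fR u v; elim=> {u v} //.
- move=> [x b]; rewrite /word_eval big_cons big_seq1 big_nil /=.
  by case: b; rewrite /= ?mulgV ?mulVg.
- by move=> u v w _ -> _ ->.
- by move=> u u' v v' _ eu _ ev; rewrite !word_eval_cat eu ev.
Qed.

Lemma presM u v : pres_of R u * pres_of R v = pres_of R (u ++ v).
Proof. exact: pres_mulE. Qed.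

Lemma presV u : (pres_of R u)^-1 = pres_of R (winv u).
Proof. exact: pres_invE. Qed.

Lemma pres_hom (G : groupType) (f : X -> G) :
  (forall u v, R u v -> word_eval f u = word_eval f v) ->
  exists h : UMagmaMorphism.type (presented R) G,
    forall w, h (pres_of R w) = word_eval f w.
Proof.
move=> fR; pose h (g : presented R) := word_eval f (pres_repr g).
have hE w : h (pres_of R w) = word_eval f w.
  exact: word_eval_cong fR _ _ (cong_repr R w).
have hM : {morph h : x y / x * y}.
  move=> x y; rewrite -[x]pres_ofK -[y]pres_ofK presM !hE.
  exact: word_eval_cat.
have h1 : h 1 = 1 by rewrite hE; exact: big_nil.
pose hm := HB.pack_for (UMagmaMorphism.type (presented R) G) h
  (isMultiplicative.Build _ _ h hM)
  (Multiplicative_isUMagmaMorphism.Build _ _ h h1).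
by exists hm.
Qed.

Lemma pres_hom_eq (G : groupType) (h h' : UMagmaMorphism.type (presented R) G) :
  (forall x, h (pres_of R [:: (x, true)]) = h' (pres_of R [:: (x, true)])) ->
  h =1 h'.
Proof.
move=> hh' g; rewrite -[g]pres_ofK; set w := pres_repr g.
elim: w => [|[x b] w IHw]; first by rewrite [LHS]gmulf1 [RHS]gmulf1.
rewrite -cat1s -presM !gmulfM {}IHw; congr (_ * _).
case: b; first exact: hh'.
by rewrite -[[:: (x, false)]]/(winv [:: (x, true)]) -presV !gmulfV hh'.
Qed.

End UniversalProperty.

(** * Conjugation and commutation of involutions *)

Section Involutions.

Local Open Scope group_scope.

Variable G : groupType.
Implicit Types x y z : G.

Lemma inv_invol x : x * x = 1 -> x^-1 = x.
Proof. exact: mulg1_eq. Qed.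

Lemma conjg_invol x y : x * x = 1 -> x ^ y * x ^ y = 1.
Proof. by move=> xx; rewrite -conjMg xx conj1g. Qed.

Lemma mulg_invol x y :
  x * x = 1 -> y * y = 1 -> commute x y -> x * y * (x * y) = 1.
Proof.
by move=> xx yy xy; rewrite {2}xy -mulgA (mulgA y) yy mul1g xx.
Qed.

Lemma invol_commute x y :
  x * x = 1 -> y * y = 1 -> x * y * (x * y) = 1 -> commute x y.
Proof.
by move=> xx yy /mulg1_eq xy; rewrite /commute -xy invgM !inv_invol.
Qed.

Lemma invol_conjg x y : y * y = 1 -> y * x = x ^ y * y.
Proof. by move=> yy; rewrite conjgE inv_invol // -!mulgA yy mulg1. Qed.

Lemma commute_conjg x y z : commute x y -> commute x z -> commute x (y ^ z).
Proof.
move=> xy xz; apply: commuteM; first exact: commuteV.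
exact: commuteM.
Qed.

Lemma conjg_commute x y : x ^ y = x -> commute x y.
Proof. by move=> xy; rewrite /commute conjgC xy. Qed.

Lemma commute_conjgE x y : commute x y -> x ^ y = x.
Proof. by move=> xy; rewrite conjgE xy mulKg. Qed.

End Involutions.

(** * Cactus relations among words in Bender-Knuth involutions *)

Section BenderKnuth.

Local Open Scope group_scope.

Variable G : groupType.
Implicit Type t : nat -> G.

Definition bkp t i : G := \prod_(a <- rev (iota 1 i)) t a.

Definition bkq t i : G := \prod_(a <- iota 1 i) bkp t a.

Lemma bkp0 t : bkp t 0 = 1.
Proof. exact: big_nil. Qed.

Lemma bkpS t i : bkp t i.+1 = t i.+1 * bkp t i.
Proof. by rewrite /bkp -[in iota _ i.+1](addn1 i) iotaD rev_cat big_cons. Qed.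

Lemma bkq0 t : bkq t 0 = 1.
Proof. exact: big_nil. Qed.

Lemma bkqS t i : bkq t i.+1 = bkq t i * bkp t i.+1.
Proof. by rewrite /bkq -[in iota _ i.+1](addn1 i) iotaD big_cat big_seq1. Qed.

(** Once the q's are involutions this is the word q_{j-1} q_{j-i} q_{j-1}; the
    conjugate form lets the identities below be chased with conjgM. *)
Definition bks t i j : G := bkq t (j - i) ^ bkq t j.-1.

Lemma commute_bkp t x m :
  (forall i, 0 < i <= m -> commute x (t i)) -> commute x (bkp t m).
Proof.
elim: m => [|m IHm] xt; first by rewrite bkp0; exact: commute1.
rewrite bkpS; apply: commuteM; first by apply: xt; rewrite leqnn.
by apply: IHm => i i_m; apply: xt; lia.
Qed.

Lemma commute_bkq t x m :
  (forall i, 0 < i <= m -> commute x (t i)) -> commute x (bkq t m).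
Proof.
elim: m => [|m IHm] xt; first by rewrite bkq0; exact: commute1.
rewrite bkqS; apply: commuteM; last exact: commute_bkp.
by apply: IHm => i i_m; apply: xt; lia.
Qed.

Lemma commute_bks t x i j : 0 < i < j ->
  (forall m, 0 < m < j -> commute x (t m)) -> commute x (bks t i j).
Proof.
move=> ij xt; apply: commute_conjg; apply: commute_bkq => m m_j;
  by apply: xt; lia.
Qed.

Variable t : nat -> G.
Hypothesis t_invol : forall i, t i * t i = 1.
Hypothesis t_commute : forall i j, i.+1 < j -> commute (t i) (t j).

Local Notation p := (bkp t).
Local Notation q := (bkq t).
Local Notation s := (bks t).

Lemma commute_t_bkq i m : m.+1 < i -> commute (t i) (q m).
Proof.
move=> m_i; apply: commute_bkq => j j_m.
by apply/commute_sym/t_commute; lia.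
Qed.

(** Mirror image of the recursion q_{i+1} = q_i p_{i+1}: in
    q_i t_{i+1} p_i, replace q_i by p_i^-1 q_{i-1} and move t_{i+1} to the left
    of q_{i-1}, which only involves t_1, ..., t_{i-1}. *)
Lemma bkqSl i : q i.+1 = (p i.+1)^-1 * q i.
Proof.
elim: i => [|i IHi]; first by rewrite bkqS bkpS bkq0 bkp0 !gsimp inv_invol.
rewrite bkqS {1}IHi (bkpS _ i.+1) (invgM (t _)) (inv_invol (t_invol _)) -!mulgA.
by congr (_ * _); rewrite bkqS !mulgA commute_t_bkq.
Qed.

(** The two recursions make q_i and its inverse satisfy the same one. *)
Lemma bkq_invol i : q i * q i = 1.
Proof.
elim: i => [|i IHi]; first by rewrite bkq0 mulg1.
by rewrite {1}bkqSl bkqS -mulgA (mulgA (q i)) IHi mul1g mulVg.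
Qed.

Lemma bkqV i : (q i)^-1 = q i.
Proof. exact: inv_invol (bkq_invol i). Qed.

Lemma bks_invol i j : s i j * s i j = 1.
Proof. exact: conjg_invol (bkq_invol _). Qed.

Lemma bksE i j : s i j = q j.-1 * q (j - i) * q j.-1.
Proof. by rewrite /bks conjgE bkqV mulgA. Qed.

Lemma bks1 j : s 1 j = q j.-1.
Proof. by rewrite /bks subn1 conjgE mulKg. Qed.

(** For m = j this is p_j = q_{j-1} q_j, which replaces the conjugator q_{j-1}
    in s i j by q_j; the factors t_m with m > j commute with s i j. *)
Lemma bks_conj_p i j m : 0 < i < j -> j <= m -> s i j ^ p m = s i.+1 j.+1.
Proof.
move=> ij; elim: m => [|m IHm]; first by lia.
rewrite leq_eqVlt => /orP[/eqP -> | j_m].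
  have -> : p m.+1 = q m * q m.+1 by rewrite bkqS mulgA bkq_invol mul1g.
  by rewrite /bks -conjgM mulgA bkq_invol mul1g subSS.
rewrite bkpS conjgM (@commute_conjgE _ _ (t m.+1)); first exact: IHm.
apply/commute_sym/commute_bks => // k k_j.
by apply/commute_sym/t_commute; lia.
Qed.

(** Since q_{j-1} = p_1 ... p_{j-1}, conjugation by q_{l-1} sends s k l to
    s 1 (l - k + 1), and each of p_l, ..., p_{j-1} then shifts it by one. *)
Lemma bks_flip1 j k l : 0 < k < l -> l <= j ->
  s k l ^ q j.-1 = s (j.+1 - l) (j.+1 - k).
Proof.
move=> kl; elim: j => [|j IHj]; first by lia.
rewrite leq_eqVlt => /orP[/eqP <- | l_j].
  rewrite subSnn bks1 subSn /=; last by lia.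
  by rewrite -conjgM bkq_invol conjg1.
have j0 : 0 < j by lia.
have -> : q j.+1.-1 = q j.-1 * p j.
  by rewrite /= -[in LHS](prednK j0) bkqS (prednK j0).
rewrite conjgM IHj // bks_conj_p; try lia.
by congr (s _ _); lia.
Qed.

(** s i j is the composite of the reversals of [1,j], [1,j-i+1] and [1,j], and
    the interval [k,l] stays inside the interval being reversed. *)
Lemma bks_flip i j k l : 0 < i -> i <= k < l -> l <= j ->
  s k l ^ s i j = s (i + j - l) (i + j - k).
Proof.
move=> i0 ikl lj.
rewrite (bksE i j) !conjgM bks_flip1; try lia.
(* q (j - i) reverses [1, j - i + 1] *)
rewrite (_ : j - i = (j - i).+1.-1) // bks_flip1; try lia.
rewrite bks_flip1; try lia.
by congr (s _ _); lia.
Qed.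

Lemma bks_commute n i j k l :
  (forall m a b, m.+1 < a < b -> b <= n -> commute (t m) (s a b)) ->
  0 < i < j -> j < k < l -> l <= n -> commute (s i j) (s k l).
Proof.
move=> ts ij jkl ln; apply/commute_sym/commute_bks => // m m_j.
by apply/commute_sym/ts => //; lia.
Qed.

(** The identity t_i = q_{i-1} q_i q_{i-1} q_{i-2}, stated so that its right
    side is the value that the cactus side assigns to t_i. At i = 1 it reads
    t_1 = q_1. *)
Lemma bk_t_from_bks i : 0 < i ->
  t i = s 1 i.+1 ^ s 1 i * s 1 i.-1.
Proof.
case: i => // -[|i] _; rewrite !bks1 !succnK.
  by rewrite bkqS bkpS bkp0 bkq0 conjg1 !gsimp.
rewrite conjgE bkqV (bkqS _ i.+1) !mulgA bkq_invol mul1g.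
by rewrite bkqSl (bkpS _ i.+1) !mulgA mulgK -mulgA bkq_invol mulg1.
Qed.

End BenderKnuth.

(** * Bender-Knuth relations among cactus elements *)

Section Cactus.

Local Open Scope group_scope.

Variables (G : groupType) (n : nat) (s : nat -> nat -> G).

(* s_{i,j} with j <= i stands for the reversal of an interval of at most one
   point *)
Hypothesis s_degenerate : forall i j, j <= i -> s i j = 1.
Hypothesis s_invol : forall i j, s i j * s i j = 1.
Hypothesis s_commute : forall i j k l,
  0 < i < j -> j < k < l -> l <= n -> commute (s i j) (s k l).
Hypothesis s_flip : forall i j k l,
  0 < i -> i <= k < l -> l <= j -> j <= n ->
  s k l ^ s i j = s (i + j - l) (i + j - k).

(** The only possible image of t_i when q_i goes to s_{1,i+1}. *)
Definition cactus_bk i : G := s 1 i.+1 ^ s 1 i * s 1 i.-1.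

Local Notation t := cactus_bk.

(** The three reversals take [1,m] to [i+1-m,i], then to [2,m+1], then to
    [i-m,i-1]; this is also how s_{1,i-1} acts. *)
Lemma prefix_conj m i : 1 < m < i -> i < n ->
  s 1 m ^ (s 1 i.+1 ^ s 1 i) = s (i - m) i.-1.
Proof.
move=> mi i_n; rewrite (conjgE (s 1 i.+1)) inv_invol // !conjgM.
rewrite (s_flip (j := i)); try lia.
rewrite (s_flip (j := i.+1)); try lia.
rewrite (s_flip (j := i)); try lia.
by congr (s _ _); lia.
Qed.

(** Both factors of t i conjugate s 1 m to s (i - m) (i - 1), and the second one
    is an involution, so their product fixes s 1 m. *)
Lemma cactus_bk_commute_prefix m i : m < i -> i < n -> commute (t i) (s 1 m).
Proof.
move=> m_i i_n; have [m1 | m1] := leqP m 1.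
  by rewrite s_degenerate //; exact: commute1.
apply/commute_sym/conjg_commute; rewrite conjgM prefix_conj ?m1 //.
have [-> | m_i1] := eqVneq m i.-1.
  by rewrite (_ : i - i.-1 = 1%N); [rewrite conjgE mulKg | lia].
rewrite s_flip; try lia.
by congr (s _ _); lia.
Qed.

(** The two factors of t i are involutions, and they commute because
    prefix_conj fixes [1,i-1]. *)
Lemma cactus_bk_invol i : 0 < i < n -> t i * t i = 1.
Proof.
move=> i_n; apply: mulg_invol => //; first exact: conjg_invol.
have [i2 | i2] := leqP i 2.
  by rewrite (@s_degenerate 1 i.-1); [exact: commute1 | lia].
apply/commute_sym/conjg_commute; rewrite prefix_conj; try lia.
by congr (s _ _); lia.
Qed.

Lemma commute_cactus_bk x i :
  (forall m, m <= i.+1 -> commute x (s 1 m)) -> commute x (t i).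
Proof.
move=> xs; apply: commuteM; last by apply: xs; lia.
by apply: commute_conjg; apply: xs.
Qed.

Lemma cactus_bk_commute i j : i.+1 < j -> j < n -> commute (t i) (t j).
Proof.
move=> ij j_n; apply/commute_sym/commute_cactus_bk => m m_i.
by apply: cactus_bk_commute_prefix => //; lia.
Qed.

Lemma cactus_bk_commute_s i j k : i.+1 < j < k -> k <= n ->
  commute (t i) (s j k).
Proof.
move=> ijk k_n; apply/commute_sym/commute_cactus_bk => m m_i.
have [m1 | m1] := leqP m 1.
  by rewrite (@s_degenerate 1 m) //; exact: commute1.
by apply/commute_sym/s_commute => //; lia.
Qed.

Lemma bkp_cactus i : i < n -> bkp t i = s 1 i * s 1 i.+1.
Proof.
elim: i => [|i IHi] i_n; first by rewrite bkp0 !s_degenerate // mulg1.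
rewrite bkpS IHi 1?ltnW // /t conjgE inv_invol //= -!mulgA.
by rewrite (mulgA (s 1 i) (s 1 i)) s_invol mul1g s_invol mulg1.
Qed.

Lemma bkq_cactus i : i < n -> bkq t i = s 1 i.+1.
Proof.
elim: i => [|i IHi] i_n; first by rewrite bkq0 s_degenerate.
by rewrite bkqS IHi 1?ltnW // bkp_cactus // mulgA s_invol mul1g.
Qed.

Lemma bks_cactus i j : 0 < i < j -> j <= n -> bks t i j = s i j.
Proof.
move=> ij j_n; rewrite /bks !bkq_cactus; try lia.
rewrite prednK; last by lia.
rewrite s_flip; try lia.
by congr (s _ _); lia.
Qed.

End Cactus.

(** * The two homomorphisms *)

Section Presentations.

Local Open Scope group_scope.

Variable n : nat.

Definition cactus_elt i j : cactus n := pres_of (@cactus_rel n) (cactus_s n i j).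

Definition bk_elt i : bk_group n := pres_of (@bk_rel n) (bk_t n i).

(** A map of words is enough here: it applies both to the projection onto the
    presented group and to evaluation at elements of a group in which the
    relations are still to be checked. *)
Lemma bk_q_hom (G : groupType) (e : word (bk_gen n) -> G) (t : nat -> G) m :
  e [::] = 1 -> (forall u v, e (u ++ v) = e u * e v) ->
  (forall i, 0 < i <= m -> e (bk_t n i) = t i) ->
  e (bk_q n m) = bkq t m.
Proof.
move=> e1 eM et.
have eflat (I : eqType) (F : I -> word (bk_gen n)) (f : I -> G) (r : seq I) :
    {in r, forall x, e (F x) = f x} ->
    e (flatten [seq F x | x <- r]) = \prod_(x <- r) f x.
  elim: r => [|x r IHr] eF; first by rewrite big_nil.
  rewrite big_cons /= eM eF ?mem_head // IHr // => y yr.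
  by rewrite eF // inE yr orbT.
apply: (eflat) => a; rewrite mem_iota => a_m.
apply: eflat => b; rewrite mem_rev mem_iota => b_a.
by apply: et; lia.
Qed.

Lemma cactus_elt_degenerate i j : j <= i -> cactus_elt i j = 1.
Proof.
move=> ji; rewrite /cactus_elt /cactus_s insubF //=.
by apply: contraTF ji => /and3P[_ ij _]; rewrite -ltnNge.
Qed.

Lemma pres_of_eq (X : choiceType) (R : word X -> word X -> Prop) u v :
  R u v -> pres_of R u = pres_of R v.
Proof. by move=> Ruv; apply/pres_ofP/pres_rel. Qed.

Lemma cactus_elt_invol i j : cactus_elt i j * cactus_elt i j = 1.
Proof.
rewrite /cactus_elt; have [/and3P[i0 ij jn] | junk] :=
  boolP [&& 0 < i, i < j & j <= n].
  by rewrite presM; apply/pres_of_eq/cactus_invol.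
by rewrite /cactus_s insubN // mulg1.
Qed.

Lemma cactus_elt_commute i j k l :
  0 < i < j -> j < k < l -> l <= n -> commute (cactus_elt i j) (cactus_elt k l).
Proof.
move=> ij jkl ln; rewrite /commute !presM; apply/pres_of_eq/cactus_comm; try lia.
by move=> m; rewrite /ivl !inE /=; lia.
Qed.

Lemma cactus_elt_flip i j k l :
  0 < i -> i <= k < l -> l <= j -> j <= n ->
  cactus_elt k l ^ cactus_elt i j = cactus_elt (i + j - l) (i + j - k).
Proof.
move=> i0 ikl lj jn; apply: (mulIg (cactus_elt i j)).
rewrite -invol_conjg ?cactus_elt_invol // !presM.
apply/pres_of_eq/cactus_flip; try lia.
by move=> m; rewrite /ivl !unfold_in; lia.
Qed.

Lemma bk_elt_invol i : bk_elt i * bk_elt i = 1.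
Proof.
rewrite /bk_elt; have [/andP[i0 i_n] | junk] := boolP (0 < i <= n - 1).
  by rewrite presM; apply/pres_of_eq/bk_invol.
by rewrite /bk_t insubN // mulg1.
Qed.

Lemma bk_elt_commute i j : i.+1 < j -> commute (bk_elt i) (bk_elt j).
Proof.
move=> ij; have [i_n | junk] := boolP (0 < i <= n - 1); last first.
  by rewrite {1}/bk_elt /bk_t insubN //; exact/commute_sym/commute1.
have [j_n | junk] := boolP (0 < j <= n - 1); last first.
  by rewrite {2}/bk_elt /bk_t insubN //; exact: commute1.
by rewrite /commute !presM; apply/pres_of_eq/bk_comm; rewrite ?ij //; lia.
Qed.

Lemma bkq_elt m : pres_of (@bk_rel n) (bk_q n m) = bkq bk_elt m.
Proof. by apply: bk_q_hom => // u v; rewrite presM. Qed.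

Lemma cactus_gen_elt (x : cactus_gen n) :
  pres_of (@cactus_rel n) [:: (x, true)] = cactus_elt (val x).1 (val x).2.
Proof. by rewrite /cactus_elt /cactus_s -surjective_pairing valK. Qed.

Lemma bk_gen_elt (x : bk_gen n) :
  pres_of (@bk_rel n) [:: (x, true)] = bk_elt (val x).
Proof. by rewrite /bk_elt /bk_t valK. Qed.

(** For involutions x and y, (x y)^2 = 1 means that x and y commute. *)
Lemma bk_elt_commute_bks i j k :
  i.+1 < j < k -> k <= n -> commute (bk_elt i) (bks bk_elt j k).
Proof.
move=> ijk kn; have [i0 | i0] := posnP i.
  by rewrite i0 /bk_elt /bk_t insubF //; exact/commute_sym/commute1.
apply: invol_commute; first exact: bk_elt_invol.
  by apply: bks_invol; [exact: bk_elt_invol | exact: bk_elt_commute].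
rewrite bksE; [| exact: bk_elt_invol | exact: bk_elt_commute].
have ij : i + 1 < j by lia.
have jk : j < k by lia.
have /pres_of_eq := bk_cactus i0 ij jk kn.
by rewrite -!presM !bkq_elt (subn1 k) (mulgA (bkq _ _)).
Qed.

Lemma gmulf_bkq (G H : groupType) (f : UMagmaMorphism.type G H)
    (t : nat -> G) (u : nat -> H) m :
  (forall i, 0 < i <= m -> f (t i) = u i) -> f (bkq t m) = bkq u m.
Proof.
move=> ftu; rewrite gmulf_prod; apply: eq_big_seq => a; rewrite mem_iota => a_m.
rewrite gmulf_prod; apply: eq_big_seq => b; rewrite mem_rev mem_iota => b_a.
by apply: ftu; lia.
Qed.

Lemma cactus_to_bk : exists f : UMagmaMorphism.type (cactus n) (bk_group n),
  forall i j, 0 < i < j -> j <= n -> f (cactus_elt i j) = bks bk_elt i j.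
Proof.
pose F (x : cactus_gen n) := bks bk_elt (val x).1 (val x).2.
have Fs i j : 0 < i < j -> j <= n ->
    word_eval F (cactus_s n i j) = bks bk_elt i j.
  move=> ij jn; rewrite /cactus_s; case: insubP => [x _ xE | /=]; last by lia.
  by rewrite /word_eval big_seq1 /F xE.
have sI i j : bks bk_elt i j * bks bk_elt i j = 1.
  by apply: bks_invol; [exact: bk_elt_invol | exact: bk_elt_commute].
have sC i j k l : 0 < i < j -> j < k < l -> l <= n ->
    commute (bks bk_elt i j) (bks bk_elt k l).
  by apply: bks_commute; exact: bk_elt_commute_bks.
suff /pres_hom[f fE] : forall u v,
    cactus_rel u v -> word_eval F u = word_eval F v.
  by exists f => i j ij jn; rewrite fE Fs.
move=> _ _ [i j i0 ij jn | i j k l i0 ij jn k0 kl ln dis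
  | i j k l i0 ij jn k0 kl ln sub]; rewrite !word_eval_cat.
- rewrite !Fs; try lia.
  by rewrite [RHS]big_nil; exact: sI.
- rewrite !Fs; try lia.
  (* two disjoint intervals are separated: otherwise the larger of the two left
     ends would lie in both *)
  have /= := dis (maxn i k); rewrite !inE /ivl => max_ij.
  have [jk | kj] := ltnP j k; first by apply: sC; rewrite ?i0 ?jk.
  by apply/commute_sym/sC => //; lia.
- have := sub l; have := sub k; rewrite /ivl !unfold_in => subk subl.
  rewrite !Fs; try lia.
  rewrite -(@bks_flip _ bk_elt bk_elt_invol bk_elt_commute i j k l); try lia.
  exact: invol_conjg (sI i j).
Qed.

Lemma bk_to_cactus : exists g : UMagmaMorphism.type (bk_group n) (cactus n),
  forall i, 0 < i < n -> g (bk_elt i) = cactus_bk cactus_elt i.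
Proof.
pose t := cactus_bk cactus_elt; pose T (x : bk_gen n) := t (val x).
have sD := cactus_elt_degenerate; have sI := cactus_elt_invol.
have sC := cactus_elt_commute; have sF := cactus_elt_flip.
have Tt i : 0 < i < n -> word_eval T (bk_t n i) = t i.
  move=> i_n; rewrite /bk_t; case: insubP => [x _ xE | ]; last by lia.
  by rewrite /word_eval big_seq1 /T xE.
have Tq m : m < n -> word_eval T (bk_q n m) = cactus_elt 1 m.+1.
  move=> m_n; rewrite -(bkq_cactus sD sI m_n).
  by apply: bk_q_hom => [|u v|i i_m];
    [exact: big_nil | exact: word_eval_cat | apply: Tt; lia].
suff /pres_hom[g gE] : forall u v, bk_rel u v -> word_eval T u = word_eval T v.
  by exists g => i i_n; rewrite gE Tt.
move=> _ _ [i i0 i_n | i j i0 i_n j0 j_n far | i j k i0 ij jk kn /=];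
  rewrite !word_eval_cat ?[RHS]big_nil.
- by rewrite Tt; [apply: (cactus_bk_invol sD sI sF); lia | lia].
- rewrite !Tt; try lia.
  case/orP: far => ij; last apply/commute_sym;
    by apply: (cactus_bk_commute sD sI sF); lia.
- have -> : word_eval T (bk_q n (k - 1)) *
      (word_eval T (bk_q n (k - j)) * word_eval T (bk_q n (k - 1))) =
      cactus_elt j k.
    rewrite !Tq; try lia.
    rewrite (_ : (k - 1)%N.+1 = k); last by lia.
    rewrite -{1}(inv_invol (sI 1%N k)) -conjgE sF; try lia.
    by congr cactus_elt; lia.
  rewrite Tt; last by lia.
  apply: mulg_invol => //; first by apply: (cactus_bk_invol sD sI sF); lia.
  by apply: (cactus_bk_commute_s sD sC) => //; lia.
Qed.

End Presentations.

Theorem mainTheorem3 (n : nat) (hn : 2 <= n) :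
  exists f : {multiplicative (cactus n) -> (bk_group n)}, bijective f.
Proof.
have [f fs] := cactus_to_bk n; have [g gt] := bk_to_cactus n.
(* q_0 = 1 is matched by the degenerate elements s_{1,1} and s_{1,0} *)
have fq j : j <= n -> f (cactus_elt n 1 j) = bkq (bk_elt n) j.-1.
  have [j1 | j1] := leqP j 1 => jn.
    by rewrite cactus_elt_degenerate // gmulf1 (_ : j.-1 = 0) ?bkq0 //; lia.
  by rewrite fs // bks1.
exists f; exists g.
- apply: (pres_hom_eq (h := g \o f) (h' := idfun)) => x /=.
  rewrite cactus_gen_elt; case: x => -[i j] /= /and3P[i0 ij jn].
  rewrite fs ?i0 // gmulfJ !(gmulf_bkq (u := cactus_bk (cactus_elt n)));
    try by move=> m m_j; apply: gt; lia.
  apply: (bks_cactus (n := n)); rewrite ?i0 //.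
  + exact: cactus_elt_degenerate.
  + exact: cactus_elt_invol.
  + exact: cactus_elt_flip.
- apply: (pres_hom_eq (h := f \o g) (h' := idfun)) => x /=.
  rewrite bk_gen_elt; case: x => i /= i_n.
  rewrite gt; last by lia.
  rewrite gmulfM gmulfJ !fq; try lia.
  rewrite -!bks1 -bk_t_from_bks //; try lia.
  + exact: bk_elt_invol.
  + exact: bk_elt_commute.
Qed.
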